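(* Let $X$ be a completely regular topological space. The following are equivalent: (1) $X$ is infraconsonant; (2) $\kappa(X)=\Lambda(X)$; (3) $\kappa(X)=\Lambda^{\downarrow}(X)$; (4) $\Lambda(X)=\Lambda^{\downarrow}(X)$; (5) $C_\kappa(X,\mathbb{R})$ is a topological vector space; (6) $C_\kappa(X,\mathbb{R})$ is a topological group (under pointwise addition); (7) $\mathcal{N}_\kappa(\overline{0})+\mathcal{N}_\kappa(\overline{0})\geq\mathcal{N}_\kappa(\overline{0})$; (8) the intersection map $\cap: C_\kappa(X,\$^{*})\times C_\kappa(X,\$^{*})\to C_\kappa(X,\$^{*})$ is jointly continuous.
   Context: Let $\mathcal{O}_X$ be the set of open subsets of $X$. For a family $\mathcal{A}$ of subsets of $X$, $\mathcal{O}_X(\mathcal{A})$ is the family of open subsets of $X$ containing an element of $\mathcal{A}$. A compact family on $X$ is a nonempty $\mathcal{A}\subseteq\mathcal{O}_X$ with $\mathcal{O}_X(\mathcal{A})=\mathcal{A}$ such that whenever $\mathcal{P}\subseteq\mathcal{O}_X$ and $\bigcup\mathcal{P}\in\mathcal{A}$, there is a finite $\mathcal{P}_0\subseteq\mathcal{P}$ with $\bigcup\mathcal{P}_0\in\mathcal{A}$ (the family $\mathcal{O}_X$ itself is allowed). $\kappa(X)$ is the set of all compact families on $X$. For a topological space $Y$, $C_\kappa(X,Y)$ is the set $C(X,Y)$ of continuous functions with the Isbell topology, having as subbase of open sets the sets $[\mathcal{A},U]=\{f\in C(X,Y): f^{-1}(U)\in\mathcal{A}\}$, for $\mathcal{A}\in\kappa(X)$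 and $U\subseteq Y$ open. $\overline{0}$ is the zero function and $\mathcal{N}_\kappa(\overline{0})$ its neighborhood filter in $C_\kappa(X,\mathbb{R})$; condition (7) means that for every $V\in\mathcal{N}_\kappa(\overline{0})$ there is $W\in\mathcal{N}_\kappa(\overline{0})$ with $W+W\subseteq V$. $\$^{*}$ is the Sierpiński space: the set $\{0,1\}$ with open sets $\varnothing,\{0\},\{0,1\}$. $C(X,\$^{*})$ is identified with $\mathcal{O}_X$ via $f\mapsto f^{-1}(\{0\})$, and then $C_\kappa(X,\$^{*})$ is $\mathcal{O}_X$ with the Scott topology, whose nonempty open sets are exactly the compact families on $X$; the map $\cap$ in (8) is $(U,V)\mapsto U\cap V$, and the domain carries the product topology. Write $\mathcal{G}\vee\mathcal{G}=\{G_1\cap G_2:G_1,G_2\in\mathcal{G}\}$. $X$ is infraconsonant if for every $\mathcal{A}\in\kappa(X)$ there is $\mathcal{G}\in\kappa(X)$ with $\mathcal{G}\vee\mathcal{G}\subseteq\mathcal{A}$. A collection $\alpha\subseteq\kappa(X)$ is self-joinable if for every $\mathcal{A}\in\alpha$ there is $\mathcal{G}\in\alpha$ with $\mathcal{G}\vee\mathcal{G}\subseteq\mathcal{A}$; it is hereditarily self-joinable if for every $\mathcal{A}\in\alpha$ and every $A\in\mathcal{A}$ there is $\mathcal{G}\in\alpha$ with $A\in\mathcal{G}$ and $\mathcal{G}\vee\mathcal{G}\subseteq\mathcal{A}$. $\Lambda(X)$ (respectively $\Lambda^{\downarrow}(X)$) is the largest self-joinable (respectively hereditarily self-joinable) subset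 of $\kappa(X)$, i.e. the union of all such collections. *)

(* Defs.v *)
From HB Require Import structures.
From mathcomp Require Import all_boot all_order all_algebra.
From mathcomp Require Import all_classical all_reals all_analysis.
Import numFieldNormedType.Exports.

Set Implicit Arguments.
Unset Strict Implicit.
Unset Printing Implicit Defensive.

Import Order.TTheory GRing.Theory Num.Theory.
Local Open Scope classical_set_scope.
Local Open Scope ring_scope.

Section compact_families.
Variable X : topologicalType.
Implicit Types (A G : set (set X)) (alpha : set (set (set X))).

Definition open_above A : set (set X) :=
  [set U | open U /\ exists2 B, A B & B `<=` U].

Definition compact_family A : Prop :=
  [/\ A !=set0, A `<=` open, open_above A = A &
      forall P : set (set X), P `<=` open -> A (\bigcup_(U in P) U) ->
      exists P0, [/\ P0 `<=` P, finite_set P0 & A (\bigcup_(U in P0) U)]].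

Definition kappa : set (set (set X)) := [set A | compact_family A].

Definition vee G : set (set X) := [set U `&` V | U in G & V in G].

Definition infraconsonant : Prop :=
  forall A, kappa A -> exists2 G, kappa G & vee G `<=` A.

Definition self_joinable alpha : Prop :=
  alpha `<=` kappa /\
  forall A, alpha A -> exists2 G, alpha G & vee G `<=` A.

Definition hereditarily_self_joinable alpha : Prop :=
  alpha `<=` kappa /\
  forall A U, alpha A -> A U -> exists G, [/\ alpha G, G U & vee G `<=` A].

Definition Lambda : set (set (set X)) :=
  \bigcup_(alpha in [set alpha | self_joinable alpha]) alpha.

Definition Lambda_down : set (set (set X)) :=
  \bigcup_(alpha in [set alpha | hereditarily_self_joinable alpha]) alpha.

Lemma self_joinable_Lambda : self_joinable Lambda.
Proof.
split=> [A [alpha [+ _]]|A [alpha sja alphaA]]; first exact.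
have [_ /(_ _ alphaA)[G aG GA]] := sja.
by exists G => //; exists alpha.
Qed.

Lemma hereditarily_self_joinable_Lambda_down :
  hereditarily_self_joinable Lambda_down.
Proof.
split=> [A [alpha [+ _]]|A U [alpha sja alphaA] AU]; first exact.
have [_ /(_ _ _ alphaA AU)[G [aG GU GA]]] := sja.
by exists G; split => //; exists alpha.
Qed.

End compact_families.
Arguments kappa X : clear implicits.
Arguments infraconsonant X : clear implicits.
Arguments Lambda X : clear implicits.
Arguments Lambda_down X : clear implicits.

(* C(X, Y) with the Isbell topology; the alias keeps it apart from the
   compact-open and pointwise topologies on continuousType. *)
Definition Ckappa (X Y : topologicalType) : Type := continuousType X Y.

Section isbell_topology.
Variables X Y : topologicalType.

HB.instance Definition _ := Choice.copy (Ckappa X Y) (continuousType X Y).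

Definition isbell_subbase (AU : set (set X) * set Y) : set (Ckappa X Y) :=
  [set f : Ckappa X Y | AU.1 ((f : X -> Y) @^-1` AU.2)].

HB.instance Definition _ := isSubBaseTopological.Build (Ckappa X Y)
  [set AU | kappa X AU.1 /\ open AU.2] isbell_subbase.

End isbell_topology.

Section pointwise_operations.
Variables (R : realType) (X : topologicalType).
Implicit Types f g h : Ckappa X R.

Definition cts0 : Ckappa X R := cst (0 : R).

Lemma ctsD_subproof f g : continuous (fun x => (f : X -> R) x + (g : X -> R) x).
Proof. by move=> x; apply: cvgD; exact: cts_fun. Qed.
Definition ctsD f g : Ckappa X R := mkcts (@ctsD_subproof f g).

Lemma ctsN_subproof f : continuous (fun x => - (f : X -> R) x).
Proof. by move=> x; apply: cvgN; exact: cts_fun. Qed.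
Definition ctsN f : Ckappa X R := mkcts (@ctsN_subproof f).

Lemma ctsZ_subproof (a : R) f : continuous (fun x => a * (f : X -> R) x).
Proof. by move=> x; apply: cvgMr; exact: cts_fun. Qed.
Definition ctsZ a f : Ckappa X R := mkcts (@ctsZ_subproof a f).

Lemma ctsDA : associative ctsD.
Proof. by move=> f g h; apply/continuousEP => x /=; exact: addrA. Qed.
Lemma ctsDC : commutative ctsD.
Proof. by move=> f g; apply/continuousEP => x /=; exact: addrC. Qed.
Lemma cts0D : left_id cts0 ctsD.
Proof. by move=> f; apply/continuousEP => x /=; exact: add0r. Qed.
Lemma ctsND : left_inverse cts0 ctsN ctsD.
Proof. by move=> f; apply/continuousEP => x /=; exact: addNr. Qed.

HB.instance Definition _ := GRing.isZmodule.Build (Ckappa X R)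
  ctsDA ctsDC cts0D ctsND.

Lemma ctsZA (a b : R) f : ctsZ a (ctsZ b f) = ctsZ (a * b) f.
Proof. by apply/continuousEP => x /=; exact: mulrA. Qed.
Lemma cts1Z : left_id (1 : R) ctsZ.
Proof. by move=> f; apply/continuousEP => x /=; exact: mul1r. Qed.
Lemma ctsZDr : right_distributive ctsZ +%R.
Proof. by move=> a f g; apply/continuousEP => x /=; exact: mulrDr. Qed.
Lemma ctsZDl f : {morph ctsZ^~ f : a b / a + b}.
Proof. by move=> a b; apply/continuousEP => x /=; exact: mulrDl. Qed.

HB.instance Definition _ := GRing.Zmodule_isLmodule.Build R (Ckappa X R)
  ctsZA cts1Z ctsZDr ctsZDl.

End pointwise_operations.

Definition is_topological_group (G : PreTopologicalZmodule.type) : Prop :=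
  continuous (fun p : G * G => p.1 + p.2) /\ continuous (-%R : G -> G).

(* No separation axiom and no local convexity are included. *)
Definition is_topological_vector_space (K : numDomainType)
    (E : preTopologicalLmodType K) : Prop :=
  is_topological_group E /\ continuous (fun p : K^o * E => p.1 *: p.2).

Definition sumset (V : nmodType) (A B : set V) : set V :=
  [set f + g | f in A & g in B].

(* The points 0 and 1 are false and true; the alias keeps the discrete
   topology of bool out of the way. *)
Definition sierpinski : Type := bool.

Section sierpinski_topology.

HB.instance Definition _ := Choice.copy sierpinski bool.

Definition sierpinski_open : set (set sierpinski) :=
  [set set0; [set false]; setT].

Lemma sierpinski_openP (U : set sierpinski) :
  sierpinski_open U <-> (U true -> U false).
Proof.
split=> [[[]->|->]//|UU].
have [Ut|Ut] := pselect (U true).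
  by right; apply/seteqP; split=> // -[] //= _; exact: UU.
have [Uf|Uf] := pselect (U false); left; [right|left].
  by apply/seteqP; split=> [[]//|[]].
by apply/seteqP; split=> [[]//|[]].
Qed.

Lemma sierpinski_openT : sierpinski_open setT.
Proof. by right. Qed.

Lemma sierpinski_openI : setI_closed sierpinski_open.
Proof.
move=> U V /sierpinski_openP UU /sierpinski_openP VV.
by apply/sierpinski_openP => -[/UU ? /VV].
Qed.

Lemma sierpinski_open_bigU (I : Type) (F : I -> set sierpinski) :
  (forall i, sierpinski_open (F i)) -> sierpinski_open (\bigcup_i F i).
Proof.
move=> oF; apply/sierpinski_openP => -[i _ Fi]; exists i => //.
by move/sierpinski_openP: (oF i); exact.
Qed.

HB.instance Definition _ := isOpenTopological.Build sierpinski
  sierpinski_openT sierpinski_openI sierpinski_open_bigU.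

End sierpinski_topology.

Lemma open_sierpinskiE : @open sierpinski = sierpinski_open.
Proof. by []. Qed.

(* The identification of C(X, $* ) with the open subsets of X: f is sent to
   zeros f, and chi is the inverse map. *)
Section open_sets.
Variable X : topologicalType.
Implicit Types f g : Ckappa X sierpinski.

Definition zeros f : set X := (f : X -> sierpinski) @^-1` [set false].

Lemma open_zeros f : open (zeros f).
Proof.
apply: open_comp => [x _|]; first exact: cts_fun.
by rewrite open_sierpinskiE; left; right.
Qed.

Lemma chi_subproof (U : set X) : open U ->
  continuous (fun x => (x \notin U) : sierpinski).
Proof.
move=> oU; apply/continuousP => B; rewrite open_sierpinskiE => -[[]->|->].
- by rewrite preimage_set0; exact: open0.
- rewrite (_ : _ @^-1` _ = U) //; apply/seteqP; split=> x /=.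
    by move/negbT; rewrite negbK inE.
  by move=> Ux; apply/negbTE; rewrite negbK inE.
- by rewrite preimage_setT; exact: openT.
Qed.
Definition chi (U : set X) (oU : open U) : Ckappa X sierpinski :=
  mkcts (chi_subproof oU).

Lemma zeros_chi (U : set X) (oU : open U) : zeros (chi oU) = U.
Proof.
apply/seteqP; split=> x; rewrite /zeros /= /mkcts.
  by move/negbT; rewrite negbK inE.
by move=> Ux; apply/negbTE; rewrite negbK inE.
Qed.

Lemma chi_zeros f : chi (open_zeros f) = f.
Proof.
apply/continuousEP => x; rewrite /= /mkcts.
case fx : ((f : X -> sierpinski) x).
  by apply/negP; rewrite inE /zeros /= fx.
by apply/negbTE; rewrite negbK inE.
Qed.

Definition cap f g : Ckappa X sierpinski :=
  chi (openI (open_zeros f) (open_zeros g)).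

Lemma zeros_cap f g : zeros (cap f g) = zeros f `&` zeros g.
Proof. exact: zeros_chi. Qed.

End open_sets.

(* Main.v *)
Require Import Defs.
From mathcomp Require Import all_boot all_order all_algebra.
From mathcomp Require Import all_classical all_reals all_analysis.
Import numFieldNormedType.Exports.
Import Order.TTheory GRing.Theory Num.Theory.
Local Open Scope classical_set_scope.
Local Open Scope ring_scope.

(** Compact families behave like open sets: they are stable under finite
    unions and intersections, and if [A] is compact then so are
    [{V | V `&` U \in A}] for [U] in [A] and [{V | V `|` W \in A}] for [W] open
    (lemmas [kappa_setIr] and [kappa_setUr]).  Combining the last two
    constructions localizes infraconsonance when [X] is regular: if the closure
    of an open set [C] lies in [U], then [U `|` ~` closure C] is the whole space,
    so that a statement about families containing [setT] yields one about
    families containing [U].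

    - Infraconsonance says that [kappa X] is self-joinable, that is
      [kappa X = Lambda X].  The localization makes [kappa X] hereditarily
      self-joinable ([infraconsonant_hereditary]), whence
      [kappa X = Lambda_down X], and then [Lambda X = Lambda_down X] because
      [Lambda_down X `<=` Lambda X `<=` kappa X].
    - Conversely let [A] be compact, [U] in [A] and [x] not in [U].  The family
      [Ox] of open neighborhoods of [x] is closed under intersection, so
      [A `|` Ox] belongs to [Lambda X].  If it belongs to [Lambda_down X], some
      compact [G] containing [U] has its pairwise intersections in [A `|` Ox];
      traces on [U] avoid [x], so [{V | V `&` U \in G}] works for [A]
      ([Lambda_eq_Lambda_down_infraconsonant]).
    - If [X] is regular and infraconsonant, every continuous map
      [phi : Y * Z -> T] induces a jointly continuous map between Isbell
      function spaces ([isbell_continuous2]).  Indeed, when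
      [phi (f, g) @^-1` O] is in [A], there are finitely many open sets [C]
      with union in [A], each with closure contained in
      [f @^-1` I `&` g @^-1` J] for some open [I], [J] with [phi] mapping
      [I `*` J] into [O].  Requiring
      [f' @^-1` I `|` ~` closure C] and [g' @^-1` J `|` ~` closure C] to lie in a
      compact family whose finite intersections fall in [A] defines
      neighborhoods of [f] and [g].  This covers addition, multiplication (hence
      scaling, through constant functions) and the intersection of open sets.
    - Conversely a neighborhood of a constant function [y] contains, for some
      compact [G], all the functions equal to [y] on a member of [G]
      ([isbell_nbhs_cst]).  For the intersection map this gives infraconsonance
      at once.  For addition at [0], complete regularity and compactness
      provide, for [U] in [G], a nonnegative function that vanishes on a member
      of [G] and equals [1] outside [U] ([kappa_bump]); if [f] and [g] are such
      functions for [U] and [V], then [f + g < 1] only inside [U `&` V]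
      ([sum_nbhs_infraconsonant]). *)

Set Implicit Arguments.
Unset Strict Implicit.
Unset Printing Implicit Defensive.

(** * Compact families *)

Section compact_families.
Context {X : topologicalType}.
Implicit Types (A B : set (set X)) (U V W : set X).

Lemma kappa_open A U : kappa X A -> A U -> open U.
Proof. by case=> _ + _ _; apply. Qed.

Lemma kappa_up A U V : kappa X A -> A U -> open V -> U `<=` V -> A V.
Proof.
move=> kA AU oV UV; have [_ _ <- _] := kA.
by split=> //; exists U.
Qed.

Lemma kappaT A : kappa X A -> A setT.
Proof.
move=> kA; have [[U AU] _ _ _] := kA.
by apply: (kappa_up kA AU) => //; exact: openT.
Qed.

(** Compactness for an indexed open cover. *)
Lemma kappa_fin A (I : choiceType) (D : set I) (S : I -> set X) : kappa X A ->
  (forall i, D i -> open (S i)) -> A (\bigcup_(i in D) S i) ->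
  exists2 s : seq I, [set` s] `<=` D & A (\bigcup_(i in [set` s]) S i).
Proof.
move=> kA oS AS; have [_ _ _ /(_ (S @` D))] := kA.
case=> [_ [i Di <-]||P [PSD /finite_seqP[t Pt] AP]]; first exact: oS.
  by rewrite bigcup_image.
(* Choose an index for each of the finitely many sets listed in [t]. *)
have [s sD ts] : exists2 s : seq I, [set` s] `<=` D &
    forall U, U \in t -> exists2 i, i \in s & U = S i.
  have {}PSD U : U \in t -> exists2 i, D i & U = S i.
    move=> Ut; have /PSD[i Di SiU] : P U by rewrite Pt.
    by exists i.
  elim: t {Pt} PSD => [|U t IHt] PSD; first by exists [::].
  have [|s sD ts] := IHt; first by move=> V Vt; apply: PSD; rewrite inE Vt orbT.
  have [i Di ->] := PSD U (mem_head _ _).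
  exists (i :: s) => [j /=|V].
    by rewrite inE => /orP[/eqP ->//|/sD].
  rewrite inE => /predU1P[->|/ts[j js ->]]; first by exists i; rewrite ?mem_head.
  by exists j; rewrite // inE js orbT.
exists s => //; apply: (kappa_up kA AP).
  by apply: bigcup_open => i /sD/oS.
by rewrite Pt => x [U /ts[i si ->] Six]; exists i.
Qed.

Lemma kappaP A : A setT -> A `<=` open ->
    (forall U V, A U -> open V -> U `<=` V -> A V) ->
    (forall P : set (set X), P `<=` open -> A (\bigcup_(U in P) U) ->
      exists2 s : seq (set X), [set` s] `<=` P & A (\bigcup_(U in [set` s]) U)) ->
  kappa X A.
Proof.
move=> AT Ao Aup Afin; split=> //; first by exists setT.
  apply/seteqP; split=> [U [oU [B AB BU]]|U AU]; first exact: Aup BU.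
  by split; [exact: Ao|exists U].
by move=> P Po /(Afin _ Po)[s sP As]; exists [set` s].
Qed.

Lemma kappa_setIr A U : kappa X A -> A U ->
  kappa X [set V | open V /\ A (V `&` U)].
Proof.
move=> kA AU; have oU := kappa_open kA AU; apply: kappaP => /=.
- by split; [exact: openT|rewrite setTI].
- by move=> V [].
- move=> V W [oV AVU] oW VW; split=> //.
  by apply: (kappa_up kA AVU); [exact: openI|exact: setSI].
move=> P Po [_]; rewrite setI_bigcupl.
case/(kappa_fin kA) => [V /Po oV|s sP As]; first exact: openI.
exists s => //; split; last by rewrite setI_bigcupl.
by apply: bigcup_open => V /sP/Po.
Qed.

Lemma kappa_setUr A W : kappa X A -> open W ->
  kappa X [set V | open V /\ A (V `|` W)].
Proof.
move=> kA oW; apply: kappaP => /=.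
- by split; [exact: openT|rewrite setTU; exact: kappaT].
- by move=> V [].
- move=> U V [oU AUW] oV UV; split=> //.
  by apply: (kappa_up kA AUW); [exact: openU|exact: setSU].
move=> P Po [_ APW].
(* Cover [\bigcup_(V in P) V `|` W] by [P] together with [W], then drop [W]. *)
have : A (\bigcup_(V in W |` P) V) by rewrite bigcup_setU1 setUC.
case/(kappa_fin kA) => [V [->//|/Po//]|s sP As].
have oP : open (\bigcup_(U in [set` [seq U <- s | U \in P]]) U).
  by apply: bigcup_open => V; rewrite /= mem_filter => /andP[/set_mem/Po].
exists [seq U <- s | U \in P].
  by move=> V /=; rewrite mem_filter => /andP[/set_mem].
split=> //; apply: (kappa_up kA As); first exact: openU.
move=> x [V sV Vx]; case: (sP V sV) => [VW|PV]; first by right; rewrite -VW.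
by left; exists V => //=; rewrite mem_filter mem_set.
Qed.

Lemma kappaI A B : kappa X A -> kappa X B -> kappa X (A `&` B).
Proof.
move=> kA kB; apply: kappaP => [||U V [AU BU] oV UV|P Po [AP BP]].
- by split; exact: kappaT.
- by move=> U [/(kappa_open kA)].
- by split; [exact: kappa_up AU oV UV|exact: kappa_up BU oV UV].
have [s sP As] := kappa_fin kA Po AP.
have [t tP Bt] := kappa_fin kB Po BP.
have stP : [set` s ++ t] `<=` P.
  by move=> V /=; rewrite mem_cat => /orP[/sP|/tP].
have ost : open (\bigcup_(U in [set` s ++ t]) U).
  by apply: bigcup_open => V /stP/Po.
exists (s ++ t) => //; split.
  apply: (kappa_up kA As ost); apply: bigcup_subset => V /= sV.
  by rewrite mem_cat sV.
apply: (kappa_up kB Bt ost); apply: bigcup_subset => V /= tV.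
by rewrite mem_cat tV orbT.
Qed.

Lemma kappaU A B : kappa X A -> kappa X B -> kappa X (A `|` B).
Proof.
move=> kA kB; apply: kappaP => [||U V [AU|BU] oV UV|P Po [AP|BP]].
- by left; exact: kappaT.
- by move=> U [/(kappa_open kA)|/(kappa_open kB)].
- by left; exact: kappa_up AU oV UV.
- by right; exact: kappa_up BU oV UV.
- by have [s sP As] := kappa_fin kA Po AP; exists s => //; left.
- by have [s sP As] := kappa_fin kB Po BP; exists s => //; right.
Qed.

(** The family of all open sets is compact, since it contains the empty union. *)
Lemma kappa_openT : kappa X open.
Proof.
apply: kappaP => //; first exact: openT.
by move=> P _ _; exists [::] => //; apply: bigcup_open.
Qed.

Lemma kappa_point (x : X) : kappa X [set U | open U /\ U x].
Proof.
apply: kappaP => [|U []//|U V [_ Ux] oV UV|P Po [_ [U PU Ux]]].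
- by split=> //; exact: openT.
- by split=> //; exact: UV.
exists [:: U] => [V|]; first by rewrite /= inE => /eqP ->.
split; last by exists U => //=; rewrite mem_head.
by apply: bigcup_open => V; rewrite /= inE => /eqP ->; exact: Po.
Qed.

End compact_families.

(** * Infraconsonance and joinability *)

Section infraconsonance.
Context {X : topologicalType}.
Implicit Types (A G : set (set X)) (U V W : set X).

Lemma kappa_eq_LambdaP : kappa X = Lambda X <-> infraconsonant X.
Proof.
split=> [kL|iX].
  rewrite /infraconsonant kL; exact: (self_joinable_Lambda X).2.
apply/seteqP; split=> [A kA|A]; last exact: (self_joinable_Lambda X).1.
by exists (kappa X) => //; split.
Qed.

Lemma Lambda_down_sub_Lambda : Lambda_down X `<=` Lambda X.
Proof.
move=> A LA; exists (Lambda_down X) => //.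
have [Lk Lh] := hereditarily_self_joinable_Lambda_down X.
split=> // B LB; have [U BU] : B !=set0 by have [] := Lk _ LB.
by have [G [LG _ GB]] := Lh _ _ LB BU; exists G.
Qed.

Lemma kappa_shrink A U : regular_space X -> kappa X A -> A U ->
  exists2 V, A V & closure V `<=` U.
Proof.
move=> rX kA AU; have oU := kappa_open kA AU.
pose D := [set V | open V /\ closure V `<=` U].
have UD : U `<=` \bigcup_(V in D) V.
  move=> x Ux; have [B xB BU] := rX x _ (open_nbhs_nbhs (conj oU Ux)).
  exists B°; last exact: xB.
  split; first exact: open_interior.
  by apply: subset_trans BU; apply: closureS; exact: interior_subset.
have AD : A (\bigcup_(V in D) V).
  by apply: (kappa_up kA AU) => //; apply: bigcup_open => V [].
have [|s sD As] := kappa_fin (D := D) (S := id) kA _ AD; first by move=> V [].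
exists (\bigcup_(V in [set` s]) V) => //.
have cls : closed (\bigcup_(V in [set` s]) closure V).
  by apply: closed_bigcup => // V _; exact: closed_closure.
have /closureS : \bigcup_(V in [set` s]) V `<=` \bigcup_(V in [set` s]) closure V.
  by apply: subset_bigcup => V _; exact: subset_closure.
move/subset_trans; apply; rewrite -(closure_id _).1//.
by apply: bigcup_sub => V /sD[].
Qed.

(** Infraconsonance provides families containing [setT]; the passage to an
    arbitrary [U] in [A] uses [V] in [A] with [closure V `<=` U]. *)
Lemma infraconsonant_hereditary : regular_space X -> infraconsonant X ->
  hereditarily_self_joinable (kappa X).
Proof.
move=> rX iX; split=> // A U kA AU.
have [V AV VU] := kappa_shrink rX kA AU.
have [G kG GA] := iX _ (kappa_setIr kA AV).
have oF : open (~` closure V) by rewrite openC; exact: closed_closure.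
exists [set W | open W /\ G (W `|` ~` closure V)]; split.
- exact: kappa_setUr.
- split; first exact: kappa_open AU.
  suff -> : U `|` ~` closure V = setT by exact: kappaT.
  by rewrite -subTset -(setUv (closure V)); exact: setSU.
move=> _ [W1 [oW1 GW1] [W2 [oW2 GW2] <-]].
have [_ AW] : [set W | open W /\ A (W `&` V)]
    ((W1 `|` ~` closure V) `&` (W2 `|` ~` closure V)).
  by apply: GA; exists (W1 `|` ~` closure V) => //; exists (W2 `|` ~` closure V).
apply: (kappa_up kA AW); first exact: openI.
by move=> x [[[W1x|nVx] [W2x|nVx2]] Vx] => //; have := subset_closure Vx.
Qed.

(** The reason is that a self-joinable member of [kappa X] can be made out of any
    compact family by adding the open neighborhoods of a single point. *)
Lemma Lambda_eq_Lambda_down_infraconsonant :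
  Lambda X = Lambda_down X -> infraconsonant X.
Proof.
move=> LL A kA.
have [[U AU /eqP UT]|AT] := pselect (exists2 U, A U & U != setT); last first.
  (* Here [setT] is the only member of [A]. *)
  exists A => // _ [U AU [V AV <-]].
  have setTE W : A W -> W = setT.
    by move=> AW; apply: contrapT => /eqP WT; apply: AT; exists W.
  by rewrite (setTE V AV) setIT.
have [x nUx] : exists x, ~ U x.
  by apply/existsNP => allU; apply: UT; rewrite -subTset => x _; exact: allU.
pose Ox := [set V | open V /\ V x].
have kOx : kappa X Ox := kappa_point x.
have OxOx : vee Ox `<=` Ox.
  by move=> _ [V [oV Vx] [W [oW Wx] <-]]; split=> //; exact: openI.
have sj : self_joinable [set A `|` Ox; Ox].
  split=> [_ [->|->]//|_ [->|->]]; first exact: kappaU.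
    by exists Ox; [right|apply: subset_trans OxOx _; exact: subsetUr].
  by exists Ox; [right|].
have : Lambda_down X (A `|` Ox).
  by rewrite -LL; exists [set A `|` Ox; Ox] => //; left.
have [Lk Lh] := hereditarily_self_joinable_Lambda_down X.
move=> /Lh/(_ (or_introl AU))[G [/Lk kG GU GA]].
exists [set V | open V /\ G (V `&` U)]; first exact: kappa_setIr.
move=> _ [V [oV GVU] [W [oW GWU] <-]].
have : (A `|` Ox) ((V `&` U) `&` (W `&` U)).
  by apply: GA; exists (V `&` U) => //; exists (W `&` U).
case=> [AVW|[_ [[_ Ux]]]]//.
apply: (kappa_up kA AVW); first exact: openI.
by move=> y [[Vy _] [Wy _]].
Qed.

(** Infraconsonance iterated, for intersections of [size s] members of [G]. *)
Lemma infraconsonant_bigcap (I : choiceType) (s : seq I) A :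
    infraconsonant X -> kappa X A ->
  exists2 G, kappa X G &
    forall F : I -> set X, (forall i, i \in s -> G (F i)) ->
      A (\bigcap_(i in [set` s]) F i).
Proof.
move=> iX; elim: s A => [|i s IHs] A kA.
  exists A => // F _; rewrite bigcap_seq big_nil; exact: kappaT.
have [H kH HA] := iX _ kA.
have [G kG GH] := IHs _ kH.
exists (G `&` H) => [|F FGH]; first exact: kappaI.
rewrite bigcap_seq big_cons -bigcap_seq; apply: HA; exists (F i).
  by have [] := FGH i (mem_head _ _).
exists (\bigcap_(j in [set` s]) F j) => //; apply: GH => j js.
by have [] : (G `&` H) (F j) by apply: FGH; rewrite inE js orbT.
Qed.

End infraconsonance.

(** * The Isbell topology *)

Section isbell.
Context {X : topologicalType}.
Implicit Types (A G : set (set X)) (U V W : set X).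

Lemma isbell_nbhs (Y : topologicalType) (f : Ckappa X Y) A (O : set Y) :
    kappa X A -> open O -> A ((f : X -> Y) @^-1` O) ->
  nbhs f [set g : Ckappa X Y | A ((g : X -> Y) @^-1` O)].
Proof.
move=> kA oO AfO; apply: (@open_nbhs_nbhs (Ckappa X Y)); split=> //.
exists [set isbell_subbase (A, O)]; last by rewrite bigcup_set1.
by move=> _ ->; exact: finI_from1.
Qed.

(** The finite intersections of subbasic open sets form a neighborhood base. *)
Lemma isbell_nbhs_sub (Y : topologicalType) (f : Ckappa X Y)
    (N : set (Ckappa X Y)) : nbhs f N ->
  exists s : seq (set (set X) * set Y),
    (forall i, i \in s ->
      [/\ kappa X i.1, open i.2 & i.1 ((f : X -> Y) @^-1` i.2)]) /\
    (forall g : Ckappa X Y,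
      (forall i, i \in s -> i.1 ((g : X -> Y) @^-1` i.2)) -> N g).
Proof.
rewrite nbhsE => -[_ [[D' D'D <-] [B D'B fB]] BN].
have [E ED EB] := D'D _ D'B.
exists (finmap.enum_fset E); split=> [i iE|g gE].
  have /set_mem[kA oO] := ED _ iE.
  split=> //; have : B f by [].
  by rewrite -EB => /(_ i); exact.
apply: BN; exists B => //.
suff : B g by [].
by rewrite -EB.
Qed.

(** The set in [G] consists of the points that are outside [closure C] or sent by
    [g] into [O]; for [g := f] it is the whole space. *)
Lemma isbell_nbhs_closure (Y : topologicalType) (f : Ckappa X Y) G (C : set X)
    (O : set Y) : kappa X G -> open O -> closure C `<=` (f : X -> Y) @^-1` O ->
  nbhs f [set g : Ckappa X Y | G ((g : X -> Y) @^-1` O `|` ~` closure C)].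
Proof.
move=> kG oO fC.
have oF : open (~` closure C) by rewrite openC; exact: closed_closure.
have : nbhs f [set g : Ckappa X Y |
    [set W | open W /\ G (W `|` ~` closure C)] ((g : X -> Y) @^-1` O)].
  apply: isbell_nbhs => //; first exact: kappa_setUr.
  split; first by apply: open_comp => // x _; exact: cts_fun.
  have -> : (f : X -> Y) @^-1` O `|` ~` closure C = setT; last exact: kappaT.
  by rewrite -subTset -(setUv (closure C)); exact: setSU.
by apply: filterS => g [].
Qed.

Lemma near_all_seq (T : Type) (F : set_system T) (I : eqType) (s : seq I)
    (P : I -> T -> Prop) : Filter F ->
    (forall i, i \in s -> \forall x \near F, P i x) ->
  \forall x \near F, forall i, i \in s -> P i x.
Proof.
move=> FF; elim: s => [|i s IHs] Ps; first exact: nearW.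
have := Ps i (mem_head _ _).
have := IHs (fun j js => Ps j (mem_behead (s := i :: s) js)).
apply: filterS2 => x sx ix j; rewrite inE => /predU1P[->//|]; exact: sx.
Qed.

(** It suffices to check continuity on the subbase. *)
Lemma isbell_continuous (S Y : topologicalType) (F : S -> Ckappa X Y) :
    (forall s A (O : set Y), kappa X A -> open O ->
      A ((F s : X -> Y) @^-1` O) ->
      \forall t \near s, A ((F t : X -> Y) @^-1` O)) ->
  continuous F.
Proof.
move=> Fc s N /isbell_nbhs_sub[E [sE EN]].
have : \forall t \near s, forall i, i \in E -> i.1 ((F t : X -> Y) @^-1` i.2).
  by apply: near_all_seq => i /sE[kA oO AO]; exact: Fc.
by apply: filterS => t; exact: EN.
Qed.

Lemma isbell_cst_continuous (Y : topologicalType) :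
  continuous (fun y => (cst y : continuousType X Y) : Ckappa X Y).
Proof.
apply: isbell_continuous => y A O kA oO AO.
have [Oy|nOy] := pselect (O y).
  have : nbhs y O by exact: open_nbhs_nbhs.
  apply: filterS => z Oz; rewrite (_ : _ @^-1` _ = setT); first exact: kappaT.
  by rewrite -subTset.
(* Otherwise [A] contains the empty set, hence every open set. *)
apply: nearW => z; apply: (kappa_up kA AO) => //.
by apply: open_comp => // x _; exact: cts_fun.
Qed.

(** Infraconsonance combines a condition on [f] with one on [g]; regularity of [X]
    lets both be stated relative to closed sets, as in [isbell_nbhs_closure]. *)
Lemma isbell_continuous2 (Y Z T : topologicalType) (phi : Y * Z -> T)
    (op : Ckappa X Y -> Ckappa X Z -> Ckappa X T) :
    regular_space X -> infraconsonant X -> continuous phi ->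
    (forall f g x, (op f g : X -> T) x = phi ((f : X -> Y) x, (g : X -> Z) x)) ->
  continuous (fun p : Ckappa X Y * Ckappa X Z => op p.1 p.2).
Proof.
move=> rX iX cphi opE; apply: isbell_continuous => -[f g] A O kA oO /= AO.
pose D := [set i : set X * (set Y * set Z) |
  [/\ open i.1, open i.2.1, open i.2.2,
    closure i.1 `<=` (f : X -> Y) @^-1` i.2.1 `&` (g : X -> Z) @^-1` i.2.2 &
    i.2.1 `*` i.2.2 `<=` phi @^-1` O]].
(* An element of [D] is a triple [(C, (I, J))]: the sets [C] cover the preimage
   of [O], and [f], [g] send [closure C] into [I], [J]. *)
have AD : A (\bigcup_(i in D) i.1).
  apply: (kappa_up kA AO); first by apply: bigcup_open => i [].
  move=> x /=; rewrite opE => Ox.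
  have : nbhs ((f : X -> Y) x, (g : X -> Z) x) (phi @^-1` O).
    exact: cphi (open_nbhs_nbhs (conj oO Ox)).
  case=> -[I J] /= [fI gJ] IJO.
  have : nbhs x ((f : X -> Y) @^-1` I° `&` (g : X -> Z) @^-1` J°).
    by apply: filterI; apply: cts_fun; exact: nbhs_interior.
  move=> /rX[C xC CIJ]; exists (C°, (I°, J°)); last exact: xC.
  split => /=; try exact: open_interior.
    by apply: subset_trans CIJ; apply: closureS; exact: interior_subset.
  by move=> [y z] [/interior_subset Iy /interior_subset Jz]; exact: (IJO (y, z)).
have [i []//|s sD As] := kappa_fin kA _ AD.
(* [H] separates the conditions on [f] from those on [g], and [G] those coming
   from the finitely many elements of [s]. *)
have [H kH HA] := iX _ (kappa_setIr kA As).
have [G kG GH] := infraconsonant_bigcap s iX kH.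
have nbf : nbhs f [set h : Ckappa X Y | forall i, i \in s ->
    G ((h : X -> Y) @^-1` i.2.1 `|` ~` closure i.1)].
  apply: (near_all_seq (F := nbhs f)) => i /sD[_ oI _ fgC _].
  by apply: isbell_nbhs_closure => // x /fgC[].
have nbg : nbhs g [set h : Ckappa X Z | forall i, i \in s ->
    G ((h : X -> Z) @^-1` i.2.2 `|` ~` closure i.1)].
  apply: (near_all_seq (F := nbhs g)) => i /sD[_ _ oJ fgC _].
  by apply: isbell_nbhs_closure => // x /fgC[].
set Nf := (N in nbhs f N) in nbf; set Ng := (N in nbhs g N) in nbg.
exists (Nf, Ng) => //.
move=> [f' g'] /= [/GH Hf /GH Hg].
have [_ AW] := HA _ (ex_intro2 _ _ _ Hf (ex_intro2 _ _ _ Hg erefl)).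
apply: (kappa_up kA AW).
  by apply: open_comp => // x _; exact: cts_fun.
move=> x [[fx gx] [i si ix]] /=; rewrite opE.
have [_ _ _ _ /(_ (_, _))] := sD _ si; apply; split => /=.
  by have [//|] := fx _ si; have := subset_closure ix.
by have [//|] := gx _ si; have := subset_closure ix.
Qed.

(** A neighborhood of a constant function only constrains functions on a member
    of some compact family. *)
Lemma isbell_nbhs_cst (Y : topologicalType) (f : Ckappa X Y) (y : Y)
    (N : set (Ckappa X Y)) : (forall x, (f : X -> Y) x = y) -> nbhs f N ->
  exists2 G, kappa X G &
    forall (g : Ckappa X Y) V, G V ->
      (forall x, V x -> (g : X -> Y) x = y) -> N g.
Proof.
move=> fy /isbell_nbhs_sub[s [sf sN]].
have [G kG Gs] : exists2 G, kappa X G &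
    forall V, G V -> forall i, i \in s -> i.1 V.
  elim: s sf {sN} => [|i s IHs] sf.
    by exists open => //; exact: kappa_openT.
  have [|G kG Gs] := IHs; first by move=> j js; apply: sf; rewrite inE js orbT.
  have [kA _ _] := sf i (mem_head _ _).
  exists (i.1 `&` G) => [|V [iV GV] j]; first exact: kappaI.
  by rewrite inE => /predU1P[->//|]; exact: Gs.
exists G => // g V GV gV; apply: sN => i si.
have [kA oO AO] := sf i si.
have ogO : open ((g : X -> Y) @^-1` i.2).
  by apply: open_comp => // x _; exact: cts_fun.
(* If [y] is not in [i.2], then [i.1] contains the empty set, hence every open
   set. *)
have [Oy|nOy] := pselect (i.2 y).
  by apply: (kappa_up kA (Gs _ GV _ si)) => // x Vx; rewrite /= gV.
apply: (kappa_up kA AO) => // x /=; rewrite fy => /nOy[].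
Qed.

End isbell.

(** * Sums of neighborhoods of zero *)

Section separation.
Context {R : realType} {X : topologicalType}.
Context (crX : completely_regular_space X).

Lemma completely_regular_bump (U : set X) x : open U -> U x ->
  exists V (f : X -> R), [/\ open V, V x & continuous f] /\
    [/\ forall y, 0 <= f y, forall y, V y -> f y = 0 &
        forall y, ~ U y -> f y = 1].
Proof.
move=> oU Ux.
have : uniform_separator [set x] (~` U) by apply: crX; [exact: open_closedC|].
move=> /(uniform_separatorP (R := R))[u [cu _ u0 u1]].
(* Truncate [u] so that it vanishes on a neighborhood of [x]. *)
pose f y : R := Num.max 0 (2 * u y - 1).
exists (u @^-1` [set r | r < 2^-1]), f; split; split.
- by apply: open_comp => //; exact: open_lt.
- rewrite /=; have -> : u x = 0 by apply: u0; exists x.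
  by rewrite invr_gt0.
- move=> y; apply: (@continuous_max R X (cst 0) (fun y => 2 * u y - 1)).
    exact: cst_continuous.
  apply: (@cvgB _ R^o); last exact: cvg_cst.
  by apply: cvgMr; exact: cu.
- by move=> y; rewrite /f le_max lexx.
- move=> y /= uy; apply/max_idPl; rewrite subr_le0 mulrC -ler_pdivlMr// div1r.
  exact: ltW.
- move=> y nUy; rewrite /f (_ : u y = 1); last by apply: u1; exists y.
  by rewrite mulr1 (_ : 2 - 1 = 1) ?max_r// -[X in X - _]natr1 addrK.
Qed.

Lemma kappa_bump A U : kappa X A -> A U ->
  exists V (f : Ckappa X R), A V /\
    [/\ forall y, 0 <= (f : X -> R) y, forall y, V y -> (f : X -> R) y = 0 &
        forall y, ~ U y -> (f : X -> R) y = 1].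
Proof.
move=> kA AU; have oU := kappa_open kA AU.
pose D := [set V | open V /\ exists f : X -> R, [/\ continuous f,
  forall y, 0 <= f y, forall y, V y -> f y = 0 & forall y, ~ U y -> f y = 1]].
have AD : A (\bigcup_(V in D) V).
  apply: (kappa_up kA AU); first by apply: bigcup_open => V [].
  move=> x Ux.
  have [V [f [[oV Vx cf] [f0 fV fU]]]] := completely_regular_bump oU Ux.
  by exists V => //; split=> //; exists f.
have [|s sD As] := kappa_fin (S := id) kA _ AD; first by move=> V [].
exists (\bigcup_(V in [set` s]) V).
suff [f [cf f0 fV fU]] : exists f : X -> R, [/\ continuous f,
    forall y, 0 <= f y, forall y, (\bigcup_(V in [set` s]) V) y -> f y = 0 &
    forall y, ~ U y -> f y = 1].
  by exists (mkcts cf : Ckappa X R).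
(* Take the product of the functions attached to the sets listed in [s]. *)
elim: s sD {As} => [|V s IHs] sD.
  exists (cst 1); split=> //; first exact: cst_continuous.
  by move=> y [].
have [|g [cg g0 gs gU]] := IHs.
  by move=> W sW; apply: sD; rewrite /= inE sW orbT.
have [_ [f [cf f0 fV fU]]] := sD V (mem_head _ _).
exists (fun y => f y * g y); split.
- by move=> y; apply: cvgM; [exact: cf|exact: cg].
- by move=> y; exact: mulr_ge0.
- move=> y [W /=]; rewrite inE => /predU1P[->|Ws] Wy; first by rewrite fV// mul0r.
  by rewrite gs ?mulr0//; exists W.
- by move=> y nUy; rewrite fU// gU// mulr1.
Qed.

Lemma sum_nbhs_infraconsonant :
  (forall V, nbhs (0 : Ckappa X R) V ->
    exists2 W, nbhs (0 : Ckappa X R) W & sumset W W `<=` V) ->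
  infraconsonant X.
Proof.
move=> sumV A kA; pose O : set R := [set r | r < 1].
have : nbhs (0 : Ckappa X R) [set h : Ckappa X R | A ((h : X -> R) @^-1` O)].
  have oO : open O by exact: open_lt.
  apply: isbell_nbhs => //.
  have -> : ((0 : Ckappa X R) : X -> R) @^-1` O = setT; last exact: kappaT.
  by rewrite -subTset => x _; exact: ltr01.
move=> /sumV[W W0 WW].
have [//|G kG GW] := isbell_nbhs_cst (y := 0) _ W0.
exists G => // _ [U GU [V GV <-]].
have [U' [f [GU' [f0 fU' fU]]]] := kappa_bump kG GU.
have [V' [g [GV' [g0 gV' gV]]]] := kappa_bump kG GV.
have Afg : A (((f + g : Ckappa X R) : X -> R) @^-1` O).
  by apply: WW; exists f; [exact: GW fU'|exists g; [exact: GW gV'|]].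
apply: (kappa_up kA Afg).
  by apply: openI; [exact: kappa_open GU|exact: kappa_open GV].
have fgE x :
  ((f + g : Ckappa X R) : X -> R) x = (f : X -> R) x + (g : X -> R) x by [].
move=> x; rewrite /O /= fgE => fg1; split; apply: contrapT.
  by move/fU => fx; move: fg1; rewrite fx gtrDl ltNge g0.
by move/gV => gx; move: fg1; rewrite gx gtrDr ltNge f0.
Qed.

End separation.

(** * The intersection map and the vector space operations *)

Section joint_continuity.
Context {X : topologicalType}.

Lemma cap_continuous_infraconsonant :
  continuous (fun p : Ckappa X sierpinski * Ckappa X sierpinski => cap p.1 p.2) ->
  infraconsonant X.
Proof.
move=> ccap A kA; pose t : Ckappa X sierpinski := chi openT.
have tE (x : X) : (t : X -> sierpinski) x = false.
  by have : zeros t x by rewrite zeros_chi.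
have ofalse : open ([set false] : set sierpinski).
  by rewrite open_sierpinskiE; left; right.
have : nbhs (cap t t) [set h : Ckappa X sierpinski | A (zeros h)].
  apply: isbell_nbhs => //; rewrite -/(zeros _) zeros_cap !zeros_chi setIT.
  exact: kappaT.
move=> /(ccap (t, t))[[N1 N2] /= [tN1 tN2] NA].
have [G kG GN] := isbell_nbhs_cst tE tN1.
have [H kH HN] := isbell_nbhs_cst tE tN2.
exists (G `&` H); first exact: kappaI.
move=> _ [U [GU _] [V [_ HV] <-]].
have oU := kappa_open kG GU; have oV := kappa_open kH HV.
have zE W (oW : open W) (x : X) : W x -> (chi oW : X -> sierpinski) x = false.
  by move=> Wx; have : zeros (chi oW) x by rewrite zeros_chi.
have := NA (chi oU, chi oV); rewrite /= zeros_cap !zeros_chi; apply.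
by split; [exact: GN GU (zE _ _)|exact: HN HV (zE _ _)].
Qed.

Context (rX : regular_space X) (iX : infraconsonant X).

(** With [false] as the open point, intersecting open sets is pointwise [||]. *)
Lemma infraconsonant_cap_continuous :
  continuous (fun p : Ckappa X sierpinski * Ckappa X sierpinski => cap p.1 p.2).
Proof.
apply: (isbell_continuous2 (op := @cap X)
  (phi := fun p : sierpinski * sierpinski => (p.1 || p.2) : sierpinski)) => //.
  apply/continuousP => B; rewrite open_sierpinskiE => -[[]->|->].
  - by rewrite preimage_set0; exact: open0.
  - pose Z : set sierpinski := [set false].
    have oZ : open Z by rewrite open_sierpinskiE; left; right.
    rewrite (_ : _ @^-1` _ = @fst sierpinski sierpinski @^-1` Z `&`
                             @snd sierpinski sierpinski @^-1` Z).
      apply: openI.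
        apply: (@open_comp (sierpinski * sierpinski)%type) => // x _.
        exact: cvg_fst.
      apply: (@open_comp (sierpinski * sierpinski)%type) => // x _.
        exact: cvg_snd.
    by apply/seteqP; split=> -[[] []] //= [].
  - by rewrite preimage_setT; exact: openT.
move=> f g x; have /seteqP[/(_ x) + /(_ x)] := zeros_cap f g.
rewrite /zeros /=; case: ((cap f g : X -> sierpinski) x);
  case: ((f : X -> sierpinski) x); case: ((g : X -> sierpinski) x) => //= h1 h2;
  by [have := h2 (conj erefl erefl)|have [] := h1 erefl].
Qed.

Lemma infraconsonant_topological_vector_space (R : realType) :
  is_topological_vector_space (Ckappa X R : preTopologicalLmodType R).
Proof.
split; first split.
- apply: (isbell_continuous2 (phi := fun p : R * R => p.1 + p.2)) => //.
  exact: (@add_continuous R^o).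
- apply: isbell_continuous => f A O kA oO AO.
  apply: (isbell_nbhs kA (O := -%R @^-1` O)) => //.
  by apply: open_comp => // r _; apply: (@cvgN _ R^o); exact: cvg_id.
(* Scaling by [a] is multiplication by the constant function [a]. *)
have mulP (f g : Ckappa X R) :
    continuous (fun x => (f : X -> R) x * (g : X -> R) x).
  by move=> x; apply: cvgM; exact: cts_fun.
pose mulop f g : Ckappa X R := mkcts (mulP f g).
have cmul : continuous (fun p : Ckappa X R * Ckappa X R => mulop p.1 p.2).
  apply: (isbell_continuous2 (phi := fun p : R * R => p.1 * p.2)) => //.
  exact: mul_continuous.
pose c (a : R^o) : Ckappa X R := (cst a : continuousType X R).
have cc : continuous c := @isbell_cst_continuous X R.
have -> : (fun p : R^o * Ckappa X R => p.1 *: p.2) = fun p => mulop (c p.1) p.2.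
  by apply/funext => -[a f]; apply/continuousEP.
move=> [a f].
apply: (@continuous2_cvg _ _ _ _ _ _
  (fun p : R^o * Ckappa X R => c p.1) snd mulop).
- exact: (cmul (c a, f)).
- by apply: cvg_comp; [exact: cvg_fst|exact: cc].
- exact: cvg_snd.
Qed.

End joint_continuity.

Unset Implicit Arguments.
Set Strict Implicit.

Theorem corollary4p6 (R : realType) (X : topologicalType)
    (crX : completely_regular_space X) :
  [<-> (* 1 *) infraconsonant X;
       (* 2 *) kappa X = Lambda X;
       (* 3 *) kappa X = Lambda_down X;
       (* 4 *) Lambda X = Lambda_down X;
       (* 5 *) is_topological_vector_space (Ckappa X R : preTopologicalLmodType R);
       (* 6 *) is_topological_group (Ckappa X R : PreTopologicalZmodule.type);
       (* 7 *) forall V, nbhs (0 : Ckappa X R) V ->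
                 exists2 W, nbhs (0 : Ckappa X R) W & sumset W W `<=` V;
       (* 8 *) continuous (fun p : Ckappa X sierpinski * Ckappa X sierpinski =>
                 cap p.1 p.2)].
Proof.
have rX : regular_space X := completely_regular_regular (R := R) crX.
tfae.
- by move/kappa_eq_LambdaP.
- move/kappa_eq_LambdaP => iX; apply/seteqP; split=> [A kA|A].
    by exists (kappa X) => //; exact: infraconsonant_hereditary.
  exact: (hereditarily_self_joinable_Lambda_down X).1.
- move=> kL; apply/seteqP; split; last exact: Lambda_down_sub_Lambda.
  by rewrite -kL; exact: (self_joinable_Lambda X).1.
- move/Lambda_eq_Lambda_down_infraconsonant => iX.
  exact: (infraconsonant_topological_vector_space rX iX).
- by case.
- move=> [addC _] V V0.
  have : nbhs ((0, 0) : Ckappa X R * Ckappa X R) ((fun p => p.1 + p.2) @^-1` V).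
    by apply: addC; rewrite /= addr0.
  case=> -[N1 N2] /= [N10 N20] NV; exists (N1 `&` N2); first exact: filterI.
  by move=> _ [f [fN _] [g [_ gN] <-]]; exact: (NV (f, g)).
- by move/(sum_nbhs_infraconsonant crX); exact: infraconsonant_cap_continuous.
- exact: cap_continuous_infraconsonant.
Qed.
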